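(* Let $a(n)$ denote the number of attainable partitions of $n$ for $n\geq 1$, and set $a(0)=1$. Then, as formal power series in $q$, \[ \sum_{n=0}^{\infty} a(n)q^n = \frac{1}{1-q}\prod_{i=1}^{\infty}\frac{1}{1-q^{i(i+1)}}. \]
   Context: A partition of a positive integer $n$ is a tuple $\lambda=(n_1,n_2,\dots,n_r)$ of positive integers with $n_1\geq n_2\geq\dots\geq n_r$ and $n_1+\dots+n_r=n$; $r$ is its length. The cyclicity index of $\lambda$ is $c(\lambda)=\sum_{i=1}^r(3-2i)n_i$. The partition $\lambda$ is called attainable if $c(\lambda)\geq 0$. *)

(* Defs.v *)
From HB Require Import structures.
From mathcomp Require Import all_boot all_order all_algebra.
From mathcomp Require Import boolp.

Set Implicit Arguments.
Unset Strict Implicit.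
Unset Printing Implicit Defensive.

Import Order.TTheory GRing.Theory Num.Theory.
Local Open Scope ring_scope.

(* A record rather than an alias of nat -> R, so that the product cannot be
   confused with the pointwise product of functions. *)
Record fps (R : Type) := Fps { fps_coef :> nat -> R }.

Lemma fpsP (R : Type) (f g : fps R) : (forall n, f n = g n) <-> f = g.
Proof.
split=> [|-> //]; case: f g => [f] [g] /= fg.
by congr Fps; apply: functional_extensionality_dep.
Qed.

HB.instance Definition _ (R : Type) := gen_eqMixin (fps R).
HB.instance Definition _ (R : Type) := gen_choiceMixin (fps R).

Section FpsRing.
Variable R : comUnitRingType.
Implicit Types f g h : fps R.

Definition fps_zero : fps R := Fps (fun=> 0).
Definition fps_opp f : fps R := Fps (fun n => - f n).
Definition fps_add f g : fps R := Fps (fun n => f n + g n).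

Fact fps_addA : associative fps_add.
Proof. by move=> f g h; apply/fpsP => n /=; rewrite addrA. Qed.
Fact fps_addC : commutative fps_add.
Proof. by move=> f g; apply/fpsP => n /=; rewrite addrC. Qed.
Fact fps_add0 : left_id fps_zero fps_add.
Proof. by move=> f; apply/fpsP => n /=; rewrite add0r. Qed.
Fact fps_addN : left_inverse fps_zero fps_opp fps_add.
Proof. by move=> f; apply/fpsP => n /=; rewrite addNr. Qed.

HB.instance Definition _ :=
  GRing.isZmodule.Build (fps R) fps_addA fps_addC fps_add0 fps_addN.

Definition fps_one : fps R := Fps (fun n => (n == 0%N)%:R).
Definition fps_mul f g : fps R :=
  Fps (fun n => \sum_(i < n.+1) f i * g (n - i)%N).

Definition fps_trunc m f : {poly R} := \poly_(i < m) f i.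

Fact fps_mul_trunc m f g n : (n < m)%N ->
  fps_mul f g n = (fps_trunc m f * fps_trunc m g)`_n.
Proof.
move=> lt_nm; rewrite coefM; apply: eq_bigr => i _; rewrite !coef_poly.
by rewrite (leq_ltn_trans (leq_ord i)) // (leq_ltn_trans (leq_subr _ _)).
Qed.

Fact fps_mulA : associative fps_mul.
Proof.
move=> f g h; apply/fpsP => n; pose T := fps_trunc n.+1.
transitivity ((T f * T g * T h)`_n); last first.
  rewrite coefM; apply: eq_bigr => i _.
  rewrite -fps_mul_trunc ?ltnS ?leq_ord // coef_poly.
  by rewrite ltnS leq_subr.
rewrite -mulrA coefM; apply: eq_bigr => i _.
rewrite -fps_mul_trunc ?ltnS ?leq_subr // coef_poly.
by rewrite ltnS leq_ord.
Qed.

Fact fps_mulC : commutative fps_mul.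
Proof.
by move=> f g; apply/fpsP => n; rewrite !(@fps_mul_trunc n.+1) // mulrC.
Qed.

Fact fps_mul1 : left_id fps_one fps_mul.
Proof.
move=> f; apply/fpsP => n /=; rewrite big_ord_recl /= mul1r subn0.
by rewrite big1 ?addr0 // => i _; rewrite mul0r.
Qed.

Fact fps_mulD : left_distributive fps_mul fps_add.
Proof.
move=> f g h; apply/fpsP => n /=; rewrite -big_split /=.
by apply: eq_bigr => i _; rewrite mulrDl.
Qed.

Fact fps_one_neq0 : fps_one != 0.
Proof. by apply/eqP => /fpsP /(_ 0%N) /eqP; rewrite oner_eq0. Qed.

HB.instance Definition _ := GRing.Zmodule_isComNzRing.Build (fps R)
  fps_mulA fps_mulC fps_mul1 fps_mulD fps_one_neq0.

Definition fps_unit : pred (fps R) := fun f => f 0%N \is a GRing.unit.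

(* The first n coefficients of the inverse of f, from the recurrence
   f 0 * g n = (n == 0) - \sum_(0 < i <= n) f i * g (n - i). *)
Fixpoint fps_inv_seq f n : seq R :=
  if n is m.+1 then
    let s := fps_inv_seq f m in
    rcons s ((f 0%N)^-1 * ((m == 0%N)%:R - \sum_(i < m) f i.+1 * s`_(m - i.+1)))
  else [::].

Definition fps_inv f : fps R :=
  if fps_unit f then Fps (fun n => (fps_inv_seq f n.+1)`_n) else f.

Fact size_fps_inv_seq f n : size (fps_inv_seq f n) = n.
Proof. by elim: n => //= n IHn; rewrite size_rcons IHn. Qed.

Fact nth_fps_inv_seq f n i : (i < n)%N ->
  (fps_inv_seq f n)`_i = (fps_inv_seq f i.+1)`_i.
Proof.
elim: n => // n IHn; rewrite ltnS leq_eqVlt => /predU1P[-> //|lt_in].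
by rewrite -IHn //= nth_rcons size_fps_inv_seq lt_in.
Qed.

Fact fps_mulV : {in fps_unit, left_inverse 1 fps_inv *%R}.
Proof.
move=> f Uf; rewrite mulrC; apply/fpsP => n.
rewrite /fps_inv; have -> : fps_unit f by [].
rewrite [LHS]/= big_ord_recl subn0 /=.
rewrite nth_rcons size_fps_inv_seq ltnn eqxx mulVKr //.
rewrite [X in _ - X + _](_ : _ = \sum_(i < n) f (bump 0 i) *
   (fps_inv_seq f (n - bump 0 i).+1)`_(n - bump 0 i)) ?subrK //.
apply: eq_bigr => i _; rewrite nth_fps_inv_seq //.
by rewrite subnSK // leq_subr.
Qed.

Fact fps_unitP f g : g * f = 1 -> f \in fps_unit.
Proof.
move=> /fpsP /(_ 0%N); rewrite /= big_ord1 subn0 => gf1.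
by apply/unitrPr; exists (g 0%N); rewrite mulrC.
Qed.

Fact fps_inv_out : {in [predC fps_unit], fps_inv =1 id}.
Proof.
move=> f; rewrite inE /= => /negPf nUf.
by rewrite /fps_inv -[fps_unit f]/(f \in fps_unit) nUf.
Qed.

HB.instance Definition _ := GRing.ComNzRing_hasMulInverse.Build (fps R)
  fps_mulV fps_unitP fps_inv_out.

Definition fpsX : fps R := Fps (fun n => (n == 1%N)%:R).

(* F is the product of u 1, u 2, ... when every coefficient of the partial
   products is eventually constant, equal to the coefficient of F. *)
Definition is_infprod (u : nat -> fps R) (F : fps R) : Prop :=
  forall n, exists M, forall m, (M <= m)%N ->
    (\prod_(1 <= i < m.+1) u i : fps R) n = F n.

Lemma is_infprod_unique u F G : is_infprod u F -> is_infprod u G -> F = G.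
Proof.
move=> uF uG; apply/fpsP => n; have [M uFM] := uF n; have [N uGN] := uG n.
by rewrite -(uFM (maxn M N)) ?leq_maxl // uGN ?leq_maxr.
Qed.

End FpsRing.

Definition is_partition (n : nat) (l : seq nat) : bool :=
  [&& sorted geq l, all (ltn 0%N) l & sumn l == n].

Record intpart (n : nat) := IntPart {
  parts :> seq nat;
  intpartP : is_partition n parts
}.

HB.instance Definition _ n := [isSub for @parts n].
HB.instance Definition _ n := [Countable of intpart n by <:].

Section IntpartFinite.
Variable n : nat.

Fact part_bound (l : intpart n) :
  (size l <= n)%N && all (fun m => (m < n.+1)%N) l.
Proof.
case: l => l /= /and3P[_ l_gt0 /eqP <-]; apply/andP; split.
  by elim: l l_gt0 => //= m l IHl /andP[m_gt0 /IHl]; rewrite -add1n; apply: leq_add.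
elim: l {l_gt0} => //= m l IHl; rewrite ltnS leq_addr /=.
by apply: sub_all IHl => k; rewrite !ltnS => /leq_trans; apply; apply: leq_addl.
Qed.

(* A partition of n, padded with zeros, is a sequence of n integers <= n. *)
Definition part_code (l : intpart n) : {ffun 'I_n -> 'I_n.+1} :=
  [ffun i : 'I_n => inord (nth 0%N l i)].

Definition part_decode (c : {ffun 'I_n -> 'I_n.+1}) : option (intpart n) :=
  insub [seq m <- [seq val (c i) | i <- enum 'I_n] | (0 < m)%N].

Fact part_codeK : pcancel part_code part_decode.
Proof.
move=> l; have /andP[size_l lt_l] := part_bound l.
have /and3P[_ l_gt0 _] := intpartP l.
rewrite /part_decode (_ : [seq _ <- _ | _] = l) ?valK //.
rewrite (_ : [seq _ | i <- _] = l ++ nseq (n - size l)%N 0%N).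
  by rewrite filter_cat (all_filterP l_gt0) filter_nseq cats0.
apply: (@eq_from_nth _ 0%N) => [|i].
  by rewrite size_map size_enum_ord size_cat size_nseq subnKC.
rewrite size_map size_enum_ord => lt_in.
rewrite (nth_map (Ordinal lt_in)) ?size_enum_ord // ffunE /= nth_enum_ord //.
rewrite nth_cat nth_nseq if_same; case: ltnP => [lt_il|le_li].
  by rewrite inordK // (allP lt_l) // mem_nth.
by rewrite nth_default // inordK.
Qed.

HB.instance Definition _ : isFinite (intpart n) := PCanIsFinite part_codeK.

End IntpartFinite.

Definition cyclicity_index (l : seq nat) : int :=
  \sum_(i < size l) (3 - 2 * (i.+1)%:Z) * (nth 0%N l i)%:Z.

Definition attainable (l : seq nat) : bool := 0 <= cyclicity_index l.

Definition num_attainable (n : nat) : nat :=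
  if n is 0%N then 1%N else #|[set l : intpart n | attainable l]|.

(* Main.v *)
Require Import Defs.
From HB Require Import structures.
From mathcomp Require Import all_boot all_order all_algebra.
From mathcomp Require Import zify.

(* Write a partition of n as n_0 >= n_1 >= ..., so that its cyclicity index is
   n - \sum_i 2 i n_i. In terms of the differences f_i = n_i - n_(i+1),
   summation by parts turns \sum_i 2 i n_i into \sum_i i (i + 1) f_i. Since n
   and the f_i with i > 0 determine the partition, a(n) is the number of finitely
   supported (f_i)_(i > 0) with \sum_i i (i + 1) f_i <= n, and a(n) - a(n - 1)
   counts those with equality, as does the product. *)

Set Implicit Arguments.
Unset Strict Implicit.
Unset Printing Implicit Defensive.

Import Order.TTheory GRing.Theory Num.Theory.

(** * Summation by parts *)

Lemma sum_by_parts (a A g : nat -> nat) M :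
    A 0 = 0 -> (forall i, A i.+1 = A i + a i) -> (forall i, g i.+1 <= g i) ->
  \sum_(i < M) a i * g i =
  \sum_(i < M) A i.+1 * (g i - g i.+1) + A M * g M.
Proof.
move=> A0 AS g_dec; elim: M => [|M IHM]; first by rewrite !big_ord0 A0.
rewrite !big_ord_recr /= {}IHM -!addnA; congr (_ + _).
by rewrite -[in RHS]mulnDr subnK // AS mulnDl.
Qed.

(** The weights [i (i + 1)] arise here, as the partial sums of [2, 4, 6, ...]. *)
Lemma sum_double_by_parts (g : nat -> nat) M : (forall i, g i.+1 <= g i) ->
  \sum_(i < M) i.+1.*2 * g i =
  \sum_(i < M) i.+1 * (i.+1 + 1) * (g i - g i.+1) + M * (M + 1) * g M.
Proof.
pose A i := i * (i + 1).
by apply: (@sum_by_parts (fun i => i.+1.*2) A) => // i; rewrite /A; lia.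
Qed.

(** In a weakly decreasing sequence the zeros come last, so the filter only cuts off a tail, which
    the default value 0 restores. *)
Lemma nth_filter_pos (s : seq nat) k : sorted geq s ->
  nth 0 [seq x <- s | 0 < x] k = nth 0 s k.
Proof.
elim: s k => //= x s IHs k path_s; have /IHs{}IHs := path_sorted path_s.
case: posnP path_s => [-> | _] path_s; last by case: k => /=.
have /allP s_le0 : all (geq 0) s.
  by apply: order_path_min path_s => a b c; rewrite /=; lia.
have s0 j : nth 0 s j = 0.
  have [lt_js|le_sj] := ltnP j (size s); last exact: nth_default.
  by apply/eqP; rewrite -leqn0; apply/s_le0/mem_nth.
by rewrite IHs s0; case: k => /=.
Qed.

(** * Attainable partitions in terms of differences of parts *)

Section Partitions.
Variable n : nat.
Implicit Type l : intpart n.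

Lemma nth_part_dec l i : nth 0 l i.+1 <= nth 0 l i.
Proof.
have /and3P[sorted_l _ _] := intpartP l.
have [lt_i|le_i] := ltnP i.+1 (size l); last by rewrite nth_default.
have geq_trans : transitive geq by move=> a b c /=; lia.
by apply: (sorted_ltn_nth geq_trans 0 sorted_l) => //; rewrite inE ltnW.
Qed.

Lemma sum_part l : \sum_(i < size l) nth 0 l i = n.
Proof.
have /and3P[_ _ /eqP sum_l] := intpartP l.
by rewrite -[RHS]sum_l sumnE (big_nth 0) big_mkord.
Qed.

Lemma sum_nth_part l m : n <= m -> \sum_(i < m) nth 0 l i = n.
Proof.
have /andP[size_l _] := part_bound l => /(leq_trans size_l) le_lm.
rewrite -[RHS](sum_part l) (big_ord_widen _ (fun i => nth 0 l i) le_lm).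
rewrite [RHS]big_mkcond /=.
by apply: eq_bigr => i _; case: ltnP => // ?; rewrite nth_default.
Qed.

Lemma nth_part_leq l i : nth 0 l i <= n.
Proof.
have [lt_i|le_i] := ltnP i (size l); last by rewrite nth_default.
by have /andP[_ /allP /(_ _ (mem_nth 0 lt_i))] := part_bound l.
Qed.

(** Parts are positive, so the default value 0 shows where the list ends. *)
Lemma eq_nth_part l l' : nth 0 l =1 nth 0 l' -> l = l'.
Proof.
suff size_le l1 l2 : nth 0 l1 =1 nth 0 l2 -> size l1 <= size l2.
  move=> eq_l; apply/val_inj/(@eq_from_nth _ 0) => [|i _]; last exact: eq_l.
  by apply/eqP; rewrite eqn_leq !size_le.
move=> eq_l; rewrite leqNgt; apply/negP => lt_l.
have /and3P[_ /allP/(_ _ (mem_nth 0 lt_l)) l1_gt0 _] := intpartP l1.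
by move: l1_gt0; rewrite /= eq_l nth_default.
Qed.

(** The largest part has weight 0 in [\sum_i 2 i n_i], so summation by parts is applied to the
    remaining parts. The boundary term vanishes because there are at most [n <= m] parts. *)
Lemma attainableE l m : n <= m ->
  attainable l =
  (\sum_(i < m) i.+1 * (i.+1 + 1) * (nth 0 l i.+1 - nth 0 l i.+2) <= n).
Proof.
move=> le_nm; have /andP[size_l _] := part_bound l.
have le_lm : size l <= m.+1 by apply/leqW/(leq_trans size_l).
have := sum_double_by_parts m (fun i => nth_part_dec l i.+1).
rewrite (nth_default _ le_lm) muln0 addn0 => <-.
have -> : \sum_(i < m) i.+1.*2 * nth 0 l i.+1 =
          \sum_(i < size l) i.*2 * nth 0 l i.
  transitivity (\sum_(i < m.+1) i.*2 * nth 0 l i).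
    by rewrite big_ord_recl.
  rewrite (big_ord_widen m.+1 (fun i => i.*2 * nth 0 l i) le_lm).
  rewrite [RHS]big_mkcond /=; apply: eq_bigr => i _.
  by case: ltnP => // ?; rewrite nth_default // muln0.
rewrite /attainable /cyclicity_index.
rewrite -[X in _ = (_ <= X)](sum_part l) -lez_nat -[RHS]subr_ge0.
rewrite !(big_morph Posz PoszD (erefl _)) -sumrB.
by congr (_ <= _)%R; apply: eq_bigr => i _; lia.
Qed.

(** Index [i] holds [f_(i+1)]; the difference [n_0 - n_1] is left out, being determined by [n]. For
    [n <= m] no difference exceeds [m], so [inord] loses nothing. *)
Definition part_diffs m l : {ffun 'I_m -> 'I_m.+1} :=
  [ffun i : 'I_m => inord (nth 0 l i.+1 - nth 0 l i.+2)].

Lemma part_diffsE m l (i : 'I_m) : n <= m ->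
  part_diffs m l i = nth 0 l i.+1 - nth 0 l i.+2 :> nat.
Proof.
move=> le_nm; rewrite ffunE inordK // ltnS (leq_trans (leq_subr _ _)) //.
exact: leq_trans (nth_part_leq _ _) le_nm.
Qed.

(** Parts beyond index [m] are 0, so descending induction recovers all parts but the largest, which
    the total [n] then gives. *)
Lemma part_diffs_inj m : n <= m -> injective (part_diffs m).
Proof.
move=> le_nm l l' eq_d.
have part_tail l0 i : m < i -> nth 0 l0 i = 0.
  move=> lt_mi; have /andP[size_l0 _] := part_bound l0.
  by rewrite nth_default // (leq_trans size_l0) // (leq_trans le_nm) // ltnW.
have eq_l i : nth 0 l i.+1 = nth 0 l' i.+1.
  elim: {i}(m - i) {-2}i (leqnn (m - i)) => [|d IHd] i le_d.
    by rewrite !part_tail // ltnS -subn_eq0 -leqn0.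
  have [le_mi|lt_im] := leqP m i; first by rewrite !part_tail.
  have := part_diffsE l (Ordinal lt_im) le_nm.
  rewrite eq_d part_diffsE //= => eq_di.
  rewrite -(subnK (nth_part_dec l i.+1)) -(subnK (nth_part_dec l' i.+1)).
  by rewrite eq_di (IHd i.+1) //; lia.
apply: eq_nth_part => -[|i //].
have sum_l (l0 : intpart n) : \sum_(i < m.+1) nth 0 l0 i = n.
  exact/sum_nth_part/leqW.
have := etrans (sum_l l) (esym (sum_l l')).
rewrite !big_ord_recl /= (eq_bigr (fun i : 'I_m => nth 0 l' i.+1)) => [|i _].
  exact: addIn.
exact: eq_l.
Qed.

(** The tail sums [t] of [f] serve as the parts after the largest one, and the largest is whatever
    is missing from [n]. *)
Lemma part_diffs_surj m (f : {ffun 'I_m -> 'I_m.+1}) : n <= m ->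
  \sum_(i < m) i.+1 * (i.+1 + 1) * f i <= n -> exists l, part_diffs m l = f.
Proof.
move=> le_nm le_fn; pose t k := \sum_(i < m | k <= i) f i.
have tS (i : 'I_m) : t i = f i + t i.+1.
  rewrite /t (bigD1 i) //=; congr (_ + _); apply: eq_bigl => j.
  by rewrite ltn_neqAle andbC eq_sym.
have t0 k : m <= k -> t k = 0.
  by move=> le_mk; apply: big1 => i; have := ltn_ord i; lia.
have t_dec k : t k.+1 <= t k.
  have [le_mk|lt_km] := leqP m k; first by rewrite !t0 // ltnW.
  by rewrite (tS (Ordinal lt_km)) leq_addl.
(* This makes the largest part [n - \sum t k] at least [t 0]. In [\sum 2 (k + 1) t k <= n], the term
   [k = 0] supplies both copies of [t 0]. *)
have le_tn : t 0 + \sum_(k < m) t k <= n.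
  apply: leq_trans le_fn; move: (sum_double_by_parts m t_dec).
  rewrite (t0 m) // muln0 addn0.
  rewrite [RHS](eq_bigr (fun i : 'I_m => i.+1 * (i.+1 + 1) * f i)) => [<-|i _].
    case: (m) t0 => [|m1] t0; first by rewrite t0 // big_ord0.
    rewrite !big_ord_recl /= addnA leq_add //; first by lia.
    by apply: leq_sum => i _; rewrite leq_pmull.
  by rewrite tS addnK.
pose s := n - \sum_(k < m) t k :: mkseq t m.
have sum_s : sumn s = n.
  have sum_t : sumn (mkseq t m) = \sum_(k < m) t k.
    by rewrite sumnE big_map -(big_mkord xpredT t) /index_iota subn0.
  by rewrite /= sum_t subnK // (leq_trans _ le_tn) // leq_addl.
have sorted_s : sorted geq s.
  apply/(pathP 0) => i; rewrite size_mkseq => lt_im.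
  case: i lt_im => [|i] lt_im /=; rewrite !nth_mkseq //; last exact: ltnW.
  by rewrite -(addnK (\sum_(k < m) t k) (t 0)) leq_sub2r.
have s_part : is_partition n [seq x <- s | 0 < x].
  apply/and3P; split; first by apply: sorted_filter sorted_s => a b c /=; lia.
    exact: filter_all.
  apply/eqP; rewrite -[RHS]sum_s !sumnE big_filter big_mkcond.
  by apply: eq_bigr => x _; case: posnP.
exists (IntPart s_part); apply/ffunP => i; apply/val_inj.
have nth_l k : nth 0 (IntPart s_part) k = nth 0 s k by apply: nth_filter_pos.
rewrite [LHS]part_diffsE // !nth_l /= nth_mkseq //.
have [lt_im|le_mi] := ltnP i.+1 m; first by rewrite /= nth_mkseq // tS addnK.
by rewrite nth_default /= ?size_mkseq // tS t0 // addn0 subn0.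
Qed.

Lemma card_attainable m : n <= m ->
  #|[set l : intpart n | attainable l]| =
  #|[set f : {ffun 'I_m -> 'I_m.+1} |
      \sum_(i < m) i.+1 * (i.+1 + 1) * f i <= n]|.
Proof.
move=> le_nm; rewrite -(card_imset _ (part_diffs_inj le_nm)).
apply: eq_card => f.
have attE l : attainable l =
    (\sum_(i < m) i.+1 * (i.+1 + 1) * part_diffs m l i <= n).
  rewrite (attainableE _ le_nm); congr (_ <= _).
  by apply: eq_bigr => i _; rewrite part_diffsE.
rewrite [RHS]inE; apply/imsetP/idP => [[l + ->]|le_fn].
  by rewrite inE attE.
have [l def_f] := part_diffs_surj le_nm le_fn.
by exists l; rewrite // inE attE def_f.
Qed.

End Partitions.

(** Leaving [m] free lets consecutive values of [n] be counted inside the same finite type. The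
    convention at 0 agrees, since the empty partition is attainable. *)
Lemma num_attainableE n m : n <= m ->
  num_attainable n =
  #|[set f : {ffun 'I_m -> 'I_m.+1} |
      \sum_(i < m) i.+1 * (i.+1 + 1) * f i <= n]|.
Proof.
move=> le_nm; rewrite -card_attainable //; case: n {le_nm} => //=.
have nil_part : is_partition 0 [::] by [].
suff -> : [set l : intpart 0 | attainable l] = [set IntPart nil_part].
  by rewrite cards1.
have nilE (l : intpart 0) : l = IntPart nil_part.
  by apply/val_inj/nilP; have /andP[] := part_bound l; rewrite leqn0.
apply/setP => l; rewrite !inE [l]nilE eqxx.
by rewrite /attainable /cyclicity_index big_ord0.
Qed.

Local Open Scope ring_scope.

(** * Coefficients of products of geometric series *)

Section FpsTheory.
Variable R : comUnitRingType.
Implicit Types f g : fps R.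

Lemma fps_addE f g n : (f + g) n = f n + g n. Proof. by []. Qed.

Lemma fps_subE f g n : (f - g) n = f n - g n. Proof. by []. Qed.

Lemma fps_sumE (I : Type) (r : seq I) (P : pred I) (F : I -> fps R) n :
  (\sum_(i <- r | P i) F i : fps R) n = \sum_(i <- r | P i) F i n.
Proof.
by rewrite (big_morph (fun f : fps R => f n) (id1 := 0) (op1 := +%R)).
Qed.

Lemma fpsX_mulE f n : (fpsX R * f) n = if n is n'.+1 then f n' else 0.
Proof.
case: n => [|n] /=; first by rewrite big_ord1 mul0r.
rewrite !big_ord_recl /= mul0r add0r mul1r subSS subn0.
by rewrite big1 ?addr0 // => i _; rewrite mul0r.
Qed.

Lemma fpsXn_mulE k f n :
  (fpsX R ^+ k * f) n = if (n < k)%N then 0 else f (n - k)%N.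
Proof.
elim: k n => [|k IHk] n; first by rewrite expr0 mul1r subn0.
by rewrite exprS -mulrA fpsX_mulE; case: n => [|n] //; rewrite IHk.
Qed.

Lemma fpsXnE k n : (fpsX R ^+ k) n = (n == k)%:R.
Proof.
rewrite -[_ ^+ k]mulr1 fpsXn_mulE; case: ltngtP => [//|lt_kn|->] /=.
  by rewrite subn_eq0 leqNgt lt_kn.
by rewrite subnn.
Qed.

Lemma unitfps_1subXn k : (0 < k)%N -> 1 - fpsX R ^+ k \is a GRing.unit.
Proof.
move=> k_gt0.
rewrite -[_ \is a _]/((1 - fpsX R ^+ k : fps R) 0%N \is a GRing.unit).
by rewrite /= fpsXnE eq_sym eqn0Ngt k_gt0 subr0 unitr1.
Qed.

Lemma fps_mul_eq N (f f' g g' : fps R) :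
    (forall n, (n <= N)%N -> f n = f' n) ->
    (forall n, (n <= N)%N -> g n = g' n) ->
  forall n, (n <= N)%N -> (f * g) n = (f' * g') n.
Proof.
move=> eq_f eq_g n le_nN; apply: eq_bigr => i _.
rewrite eq_f ?eq_g //; first exact: leq_trans (leq_subr _ _) le_nN.
by rewrite (leq_trans _ le_nN) // -ltnS.
Qed.

(** The remainder of the geometric series, [X^(k (N + 1)) / (1 - X^k)], has no term of degree at
    most [N]. *)
Lemma fps_inv_1subXn k N n : (0 < k)%N -> (n <= N)%N ->
  (1 - fpsX R ^+ k)^-1 n = (\sum_(j < N.+1) fpsX R ^+ (k * j) : fps R) n.
Proof.
move=> k_gt0 le_nN; set x := fpsX R ^+ k.
have Ux : 1 - x \is a GRing.unit by apply: unitfps_1subXn.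
have -> : (1 - x)^-1 =
    \sum_(j < N.+1) fpsX R ^+ (k * j) + fpsX R ^+ (k * N.+1) * (1 - x)^-1.
  apply: (mulrI Ux); rewrite mulrDr mulrCA !mulrV // mulr1.
  rewrite (eq_bigr (fun j : 'I_N.+1 => x ^+ j)) => [|j _]; last exact: exprM.
  by rewrite exprM -/x -opprB mulNr -subrX1 opprB subrK.
rewrite fps_addE fpsXn_mulE ifT ?addr0 //.
by rewrite (leq_trans (n := N.+1)) ?ltnS // leq_pmull.
Qed.

(** Once each factor is truncated to a finite geometric sum, distributivity yields one monomial for
    each choice [f] of exponents. *)
Lemma fps_prod_inv_1subXn m N n (w : 'I_m -> nat) :
    (forall i, (0 < w i)%N) -> (n <= N)%N ->
  (\prod_(i < m) (1 - fpsX R ^+ w i)^-1 : fps R) n =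
  #|[set f : {ffun 'I_m -> 'I_N.+1} | (\sum_(i < m) w i * f i)%N == n]|%:R.
Proof.
move=> w_gt0 le_nN.
transitivity
    ((\prod_(i < m) \sum_(j < N.+1) fpsX R ^+ (w i * j) : fps R) n).
  move: n le_nN; apply: (big_ind2 (fun f g : fps R =>
      forall n, (n <= N)%N -> f n = g n)) => // [f f' g g'|i _ n le_nN].
    exact: fps_mul_eq.
  exact: fps_inv_1subXn.
rewrite bigA_distr_bigA fps_sumE -sum1_card natr_sum [RHS]big_mkcond /=.
apply: eq_bigr => f _; rewrite inE -(big_morph _ (exprD _) (expr0 _)) fpsXnE.
by rewrite eq_sym; case: eqP.
Qed.

End FpsTheory.

Theorem theorem1p1 :
  exists2 P : fps int,
    is_infprod (fun i : nat => (1 - fpsX int ^+ (i * (i + 1))%N)^-1) P &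
    Fps (fun n : nat => (num_attainable n)%:Z) = (1 - fpsX int)^-1 * P.
Proof.
(* The required identity forces this witness; what remains is that the product converges to it. *)
set A := Fps _; exists ((1 - fpsX int) * A); last first.
  by rewrite mulKr // -[fpsX int]expr1 unitfps_1subXn.
move=> n; exists n => m le_nm; rewrite big_add1 big_mkord.
rewrite (@fps_prod_inv_1subXn _ m m) //.
rewrite mulrBl mul1r fps_subE fpsX_mulE.
rewrite natz [A n]/= (num_attainableE le_nm).
case: n le_nm => [|n] le_nm.
  by rewrite subr0; congr Posz; apply: eq_card => f; rewrite !inE leqn0.
rewrite /= (num_attainableE (ltnW le_nm)); apply/eqP.
rewrite eq_sym subr_eq -PoszD; apply/eqP; congr Posz.
(* The functions of weight at most [n.+1] split disjointly into those of weight exactly [n.+1] and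
   those of weight at most [n]. *)
rewrite -cardsUI [X in (_ + X)%N]eq_card0 ?addn0 => [|f].
  by apply: eq_card => f; rewrite !inE leq_eqVlt ltnS.
by rewrite !inE; case: eqP => // ->; rewrite ltnn.
Qed.
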